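(* Let $n\ge 2$ be an integer and let $S_n$ be the set of all permutations of $[n]=\{1,\dots,n\}$. Then: (i) The maximum cardinality of a minimal pair-complete subset of $S_n$ is $\gamma_P(n)=\max\{n,\lfloor n^2/4\rfloor\}$. (ii) For all $n\ge 5$, the family $\mathcal{P}^*_n$ of all maximum-cardinality minimal pair-complete subsets of $S_n$ equals $\{\tau\circ Q:\tau\in S_n,\ Q\in\mathcal{Q}^*_n\}$, where $\mathcal{Q}^*_n$ is the family of all maximum-cardinality minimal inversion-complete subsets of $S_n$ and $\tau\circ Q=\{\tau\circ\pi:\pi\in Q\}$. (iii) For all $n\ge 5$ there is a bijection between $\mathcal{P}^*_n$ and the Cartesian product $\binom{[n]}{\lfloor n/2\rfloor}\times\mathcal{Q}^*_n$, where $\binom{[n]}{\lfloor n/2\rfloor}$ is the family of all subsets of $[n]$ of cardinality $\lfloor n/2\rfloor$.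
   Context: Permutations $\pi\in S_n$ are written as sequences $(\pi(1),\dots,\pi(n))$; $\tau\circ\pi$ is the composition $k\mapsto\tau(\pi(k))$. A permutation $\pi$ covers the ordered pair $(\pi(k),\pi(l))$ iff $k<l$. Let $A_n=\{(i,j): i,j\in[n], i\ne j\}$ and let an inversion be an ordered pair $(j,i)$ with $1\le i<j\le n$. A set $P\subseteq S_n$ is pair-complete if every pair in $A_n$ is covered by at least one permutation in $P$, and minimally pair-complete if moreover no proper subset of $P$ is pair-complete. Similarly $Q\subseteq S_n$ is inversion-complete if every inversion is covered by some permutation of $Q$, and minimally inversion-complete if no proper subset is inversion-complete. *)

(* Defs.v *)
From mathcomp Require Import all_boot all_fingroup.

Set Implicit Arguments.
Unset Strict Implicit.
Unset Printing Implicit Defensive.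

(* [n] is represented by 'I_n, i.e. by {0, ..., n-1}; the shift by one preserves
   the order, hence both coverage and inversions. *)

Section PairComplete.

Variable n : nat.

Definition covers (pi : 'S_n) (p : 'I_n * 'I_n) : bool :=
  [exists k : 'I_n, exists l : 'I_n, (k < l) && ((pi k, pi l) == p)].

Definition pairs : {set 'I_n * 'I_n} := [set p | p.1 != p.2].

Definition inversions : {set 'I_n * 'I_n} := [set p : 'I_n * 'I_n | p.2 < p.1].

Definition pair_complete (P : {set 'S_n}) : bool :=
  [forall p in pairs, exists pi in P, covers pi p].

Definition inversion_complete (Q : {set 'S_n}) : bool :=
  [forall p in inversions, exists pi in Q, covers pi p].

Definition min_pair_complete (P : {set 'S_n}) : bool := minset pair_complete P.

Definition min_inversion_complete (Q : {set 'S_n}) : bool :=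
  minset inversion_complete Q.

Definition gammaP : nat := \max_(P : {set 'S_n} | min_pair_complete P) #|P|.

Definition gammaQ : nat :=
  \max_(Q : {set 'S_n} | min_inversion_complete Q) #|Q|.

Definition Pstar : {set {set 'S_n}} :=
  [set P | min_pair_complete P & #|P| == gammaP].

Definition Qstar : {set {set 'S_n}} :=
  [set Q | min_inversion_complete Q & #|Q| == gammaQ].

(* The product of permutations applies its left factor first, so
   (pi * tau) k = tau (pi k), which is the composite of tau after pi. *)
Definition compset (tau : 'S_n) (Q : {set 'S_n}) : {set 'S_n} :=
  [set (pi * tau)%g | pi in Q].

End PairComplete.

(* Main.v *)
Require Import Defs.
From mathcomp Require Import all_boot all_fingroup zify.

(* In a minimal complete set P each permutation has a private pair; choosing one
   for each gives an oriented graph C with |C| = |P| such that reversing all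
   arcs of C but one is always realised by a linear order.  If |P| > 3, this
   forces C to be triangle-free, and Mantel's theorem gives |P| <= n^2/4.  In
   the case of equality with n >= 5, C is an orientation of a balanced complete
   bipartite graph, and pair-completeness rules out directed paths of length 2,
   so C consists of all arcs from A to its complement for a set A determined
   by P.  Relabelling A as a final segment makes all arcs of C inversions and
   turns P into a maximum minimal inversion-complete set; conversely a maximum
   minimal inversion-complete set is pair-complete, because any two vertices of
   C are adjacent or have a common neighbour. *)

Set Implicit Arguments.
Unset Strict Implicit.
Unset Printing Implicit Defensive.

(** * Mantel's theorem with its equality case *)

Definition adj (T : finType) (C : {set T * T}) (x y : T) : bool :=
  ((x, y) \in C) || ((y, x) \in C).

Lemma adjC (T : finType) (C : {set T * T}) x y : adj C x y = adj C y x.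
Proof. exact: orbC. Qed.

(* For [N] the neighbourhood of a vertex of maximal degree, every edge has an
   end outside the independent set [N], so the degrees outside [N] already
   count all the edges. *)
Lemma mantel (T : finType) (C : {set T * T}) :
    (forall x y, (x, y) \in C -> (y, x) \notin C) ->
    (forall x y z, adj C x y -> adj C y z -> adj C x z -> False) ->
  exists N : {set T}, #|C| <= #|N| * #|~: N| /\
    (#|C| = #|N| * #|~: N| -> forall x y, adj C x y = ((x \in N) != (y \in N))).
Proof.
move=> asymC trifree.
have [x0 _|T0] := pickP (@predT T); last first.
  exists set0; split=> [|_ x]; last by have := T0 x.
  by rewrite [#|C|]eq_card0 // => -[x y]; have := T0 x.
pose nb x := [set y | adj C x y].
have [v _ vmax] := @arg_maxnP T x0 predT (fun v => #|nb v|) isT.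
set N := nb v in vmax *; exists N.
have indepN x y : x \in N -> y \in N -> ~~ adj C x y.
  by rewrite !inE => vx vy; apply/negP => xy; apply: (trifree v x y).
pose EB := [set p : T * T | (p.1 \in ~: N) && adj C p.1 p.2].
have EBcard : #|EB| = \sum_(x in ~: N) #|nb x|.
  under eq_bigr do rewrite /nb -sum1dep_card.
  by rewrite pair_big_dep /= sum1dep_card.
have sum_le : \sum_(x in ~: N) #|nb x| <= \sum_(x in ~: N) #|N|
    ?= iff [forall (x | x \in ~: N), #|nb x| == #|N|].
  by apply: leqif_sum => x _; apply: leqif_eq; apply: vmax.
have constE : \sum_(x in ~: N) #|N| = #|N| * #|~: N|.
  by rewrite sum_nat_const mulnC.
(* Reorient each arc so that it starts outside [N]; asymmetry of [C] keeps this injective. *)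
pose g (p : T * T) := if p.1 \in N then (p.2, p.1) else p.
have ginj : {in C &, injective g}.
  move=> [a b] [c d] abC cdC; rewrite /g /=.
  case: ifP => _; case: ifP => _ [E1 E2]; subst=> //.
    by have := asymC _ _ abC; rewrite cdC.
  by have := asymC _ _ abC; rewrite cdC.
have gsub : g @: C \subset EB.
  apply/subsetP=> _ /imsetP[[a b] abC ->]; rewrite inE /g /=.
  have ab : adj C a b by rewrite /adj abC.
  case: ifP => aN /=; rewrite in_setC; last by rewrite aN ab.
  rewrite adjC ab andbT; apply/negP=> bN.
  by move: (indepN a b aN bN); rewrite ab.
have CleEB : #|C| <= #|EB| by rewrite -(card_in_imset ginj) subset_leq_card.
split=> [|Ceq].
  by rewrite -constE (leq_trans CleEB) // EBcard sum_le.
have EBeq : #|EB| = #|N| * #|~: N|.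
  apply/eqP; rewrite eqn_leq -{2}Ceq CleEB andbT -constE EBcard.
  by rewrite sum_le.
have gEB : g @: C = EB.
  by apply/eqP; rewrite eqEcard gsub (card_in_imset ginj) EBeq Ceq leqnn.
have degB x : x \notin N -> #|nb x| = #|N|.
  move=> xN; have := sum_le.2; rewrite -EBcard constE EBeq eqxx.
  by move/esym/forall_inP/(_ x); rewrite inE => /(_ xN)/eqP.
(* Such an edge would lie in [EB] in both orders, and [g] swaps only arcs that start in [N], so both
   orders would belong to [C]. *)
have indepB x y : x \notin N -> y \notin N -> ~~ adj C x y.
  move=> xN yN; apply/negP=> xy.
  have inC a b : a \notin N -> b \notin N -> adj C a b -> (a, b) \in C.
    move=> aN bN ab; have : (a, b) \in EB by rewrite !inE in aN *; rewrite aN.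
    rewrite -gEB => /imsetP[[c d] cdC]; rewrite /g /=.
    case: ifP => cN [E1 E2]; subst=> //.
    by rewrite cN in bN.
  have := asymC _ _ (inC x y xN yN xy).
  by rewrite inC // adjC.
have nbB x : x \notin N -> nb x = N.
  move=> xN; apply/eqP; rewrite eqEcard degB // leqnn andbT.
  apply/subsetP=> y; rewrite inE => xy; apply/negPn/negP => yN.
  by move: (indepB x y xN yN); rewrite xy.
move=> x y; have [xN|xN] := boolP (x \in N); have [yN|yN] := boolP (y \in N) => /=.
- exact/negbTE/indepN.
- by move: xN; rewrite -(nbB y yN) inE adjC.
- by move: yN; rewrite -(nbB x xN) inE.
- exact/negbTE/indepB.
Qed.

(** * Permutations as linear orders *)

Definition pos n (pi : 'S_n) (x : 'I_n) : nat := (pi^-1)%g x.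

Lemma coversE n (pi : 'S_n) x y : covers pi (x, y) = (pos pi x < pos pi y).
Proof.
apply/existsP/idP => [[k /existsP[l /andP[kl /eqP[<- <-]]]]|lt_xy].
  by rewrite /pos !permK.
exists ((pi^-1)%g x); apply/existsP; exists ((pi^-1)%g y).
by rewrite lt_xy !permKV eqxx.
Qed.

Lemma pos_neq n (pi : 'S_n) x y : x != y -> pos pi x != pos pi y.
Proof. by apply: contra => /eqP/val_inj/perm_inj ->. Qed.

Lemma coversM n (pi tau : 'S_n) x y :
  covers (pi * tau)%g (tau x, tau y) = covers pi (x, y).
Proof. by rewrite !coversE /pos invMg !permM !permK. Qed.

Lemma perm_of_rank n (r : 'I_n -> nat) :
  exists pi : 'S_n, forall x y, r x < r y -> covers pi (x, y).
Proof.
(* The index breaks the ties of [r]; counting the elements of smaller key then gives a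
   permutation. *)
pose r' (x : 'I_n) := r x * n + x.
have r'inj : injective r'.
  move=> x y /(congr1 (modn^~ n)); rewrite !modnMDl !modn_small //.
  exact: val_inj.
pose s (x : 'I_n) := #|[set y | r' y < r' x]|.
have smono x y : r' x < r' y -> s x < s y.
  move=> xy; apply: proper_card; apply/properP; split.
    by apply/subsetP=> z; rewrite !inE => /ltn_trans; apply.
  by exists x; rewrite inE ?ltnn.
have slt x : s x < n.
  rewrite -[X in _ < X]card_ord -cardsT; apply: proper_card.
  by apply/properP; split; [exact: subsetT | exists x; rewrite ?inE ?ltnn].
have sinj : injective (fun x => Ordinal (slt x)).
  move=> x y [] E; apply: r'inj.
  by case: (ltngtP (r' x) (r' y)) => // /smono; rewrite E ltnn.
exists (perm sinj)^-1%g => x y xy; rewrite coversE /pos invgK !permE /=.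
by apply: smono; rewrite /r'; move: (ltn_ord x) (ltn_ord y); nia.
Qed.

(** * Minimal complete sets and private pairs *)

(** Common generalisation of [pair_complete] and [inversion_complete], both convertible to an
    instance of it. *)
Definition complete n (T : {set 'I_n * 'I_n}) (P : {set 'S_n}) : bool :=
  [forall p in T, exists pi in P, covers pi p].

Lemma completeP n (T : {set 'I_n * 'I_n}) (P : {set 'S_n}) :
  reflect (forall p, p \in T -> exists2 pi, pi \in P & covers pi p)
          (complete T P).
Proof.
apply: (iffP forall_inP) => H p pT.
  by have /exists_inP[pi piP pip] := H p pT; exists pi.
by have [pi piP pip] := H p pT; apply/exists_inP; exists pi.
Qed.

(* A set [C] of pairs matched with [P] so that each permutation of [P] covers
   its own pair and no other pair of [C]. *)
Definition critical n (P : {set 'S_n}) (C : {set 'I_n * 'I_n}) : bool :=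
  [exists f : {ffun 'S_n -> 'I_n * 'I_n},
     (f @: P == C) && [forall pi in P, forall rho in P,
                         covers pi (f rho) == (pi == rho)]].

Lemma criticalP n (P : {set 'S_n}) (C : {set 'I_n * 'I_n}) :
  reflect (exists2 f : {ffun 'S_n -> 'I_n * 'I_n}, f @: P = C &
             {in P &, forall pi rho, covers pi (f rho) = (pi == rho)})
          (critical P C).
Proof.
apply: (iffP existsP) => [[f /andP[/eqP fP /forall_inP H]]|[f fP H]]; exists f => //.
  by move=> pi rho piP rhoP; have /forall_inP/(_ rho rhoP)/eqP := H pi piP.
rewrite fP eqxx; apply/forall_inP=> pi piP; apply/forall_inP=> rho rhoP.
by rewrite H.
Qed.

(** Deleting [pi] from a minimal set leaves some pair of [T] uncovered, and that pair is private to
    [pi]. Conversely, a permutation with a private pair in [T] cannot be deleted. *)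
Lemma minset_completeP n (T : {set 'I_n * 'I_n}) (P : {set 'S_n}) : 0 < n ->
  reflect (complete T P /\ exists2 C : {set 'I_n * 'I_n}, C \subset T & critical P C)
          (minset (complete T) P).
Proof.
move=> n_gt0; apply: (iffP idP) => [/minsetP[cP minP]|[cP [C CT /criticalP[f fP H]]]].
  split=> //.
  have priv pi : exists c, pi \in P ->
      c \in T /\ {in P, forall rho, covers rho c = (rho == pi)}.
    have [piP|] := boolP (pi \in P); last by exists (Ordinal n_gt0, Ordinal n_gt0).
    have : ~~ complete T (P :\ pi).
      apply/negP=> /minP/(_ (subsetDl _ _)) E.
      by move: piP; rewrite -E setD11.
    case/forall_inPn=> c cT /exists_inPn Hc; exists c => _; split=> // rho rhoP.
    have [->|ne] := eqVneq rho pi; last by apply/negbTE/Hc; rewrite !inE ne.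
    have [rho' rho'P cov] := completeP _ _ cP c cT.
    have [<- //|ne'] := eqVneq rho' pi.
    by have := Hc rho'; rewrite !inE ne' rho'P cov => /(_ isT).
  have [f fE] := fin_all_exists priv.
  exists ([ffun pi => f pi] @: P).
    by apply/subsetP=> _ /imsetP[pi piP ->]; rewrite ffunE; case: (fE pi piP).
  apply/criticalP; exists [ffun pi => f pi] => // pi rho piP rhoP.
  by rewrite ffunE; case: (fE rho rhoP) => _ ->.
apply/minsetP; split=> // Q cQ QP; apply/eqP; rewrite eqEsubset QP /=.
apply/subsetP=> pi piP.
have : f pi \in T by apply: (subsetP CT); rewrite -fP imset_f.
case/(completeP _ _ cQ)=> rho rhoQ.
by rewrite H // => [/eqP <- //|]; apply: (subsetP QP).
Qed.

Lemma critical_card n (P : {set 'S_n}) C : critical P C -> #|C| = #|P|.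
Proof.
case/criticalP=> f <- H; apply: card_in_imset => pi rho piP rhoP E.
by apply/eqP; rewrite -H // -E H ?eqxx.
Qed.

(** * Forbidden configurations and the upper bound *)

(** Acyclicity in disguise: the graph obtained from [C] by reversing all arcs except [c] embeds in a
    linear order. *)
Definition flips n (C : {set 'I_n * 'I_n}) (pi : 'S_n) (c : 'I_n * 'I_n) :=
  pos pi c.1 < pos pi c.2 /\
  forall x y, (x, y) \in C -> (x, y) != c -> pos pi y < pos pi x.

Lemma pairs_neq n (C : {set 'I_n * 'I_n}) x y :
  C \subset pairs n -> (x, y) \in C -> x != y.
Proof. by move=> CT /(subsetP CT); rewrite inE. Qed.

Lemma critical_flips n (P : {set 'S_n}) C pi :
  critical P C -> C \subset pairs n -> pi \in P ->
  exists2 c, c \in C & flips C pi c.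
Proof.
move=> /criticalP[f fP H] CT piP; exists (f pi); first by rewrite -fP imset_f.
split.
  by rewrite -coversE -surjective_pairing H ?eqxx.
move=> x y xyC ne; have := pos_neq pi (pairs_neq CT xyC).
have : ~~ covers pi (x, y).
  move: xyC ne; rewrite -fP => /imsetP[rho rhoP ->]; rewrite H //.
  by apply: contra => /eqP ->.
by rewrite coversE; lia.
Qed.

Lemma critical_flipper n (P : {set 'S_n}) C c :
  critical P C -> C \subset pairs n -> c \in C ->
  exists2 pi, pi \in P & flips C pi c.
Proof.
move=> cr CT; have /criticalP[f fP H] := cr.
rewrite -{1}fP => /imsetP[pi piP cE]; exists pi => //.
have [c' c'C [lt' fl]] := critical_flips cr CT piP.
suff -> : c = c' by [].
apply/eqP/negPn/negP => ne; have : covers pi c by rewrite cE H ?eqxx.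
have : c \in C by rewrite cE -fP imset_f.
by case: c ne {cE} => x y ne /fl/(_ ne); rewrite coversE; lia.
Qed.

(** By counting, some arc of [C] lies outside [s], and its flipper reverses all arcs of [C] in [s]
    at once. Hence fewer than [#|C|] arcs never form a directed cycle. *)
Lemma critical_avoid n (P : {set 'S_n}) C (s : seq ('I_n * 'I_n)) :
  critical P C -> C \subset pairs n -> size s < #|C| ->
  exists2 pi, pi \in P &
    forall x y, (x, y) \in C -> (x, y) \in s -> pos pi y < pos pi x.
Proof.
move=> cr CT lts.
have [c cC cs] : exists2 c, c \in C & c \notin s.
  apply/subsetPn; apply: contraL lts => /subset_leq_card.
  by rewrite -leqNgt => /leq_trans; apply; apply: card_size.
have [pi piP [_ fl]] := critical_flipper cr CT cC.
exists pi => // x y xyC xys; apply: fl => //.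
by apply: contraNneq cs => <-.
Qed.

Lemma critical_asym n (P : {set 'S_n}) C x y :
  critical P C -> C \subset pairs n -> 2 < #|C| ->
  (x, y) \in C -> (y, x) \notin C.
Proof.
move=> cr CT C3 xy; apply/negP=> yx.
have [pi _ H] := @critical_avoid _ _ _ [:: (x, y); (y, x)] cr CT C3.
have := H _ _ xy; have := H _ _ yx; rewrite !inE !eqxx orbT.
by move=> /(_ isT) ? /(_ isT); lia.
Qed.

(** In a transitive triangle, the flipper of the long arc reverses the other two, which contradicts
    that arc. A cyclic triangle is excluded by [critical_avoid], whence the bound 3. *)
Lemma critical_triangle_free n (P : {set 'S_n}) C :
  critical P C -> C \subset pairs n -> 3 < #|C| ->
  forall x y z, adj C x y -> adj C y z -> adj C x z -> False.
Proof.
move=> cr CT C4.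
have trans x y z : (x, y) \in C -> (y, z) \in C -> (x, z) \in C -> False.
  move=> xy yz xz; have [pi _ [/= lt fl]] := critical_flipper cr CT xz.
  have := fl _ _ xy; have := fl _ _ yz; rewrite !xpair_eqE !eqxx andbT /=.
  rewrite [y == x]eq_sym (pairs_neq CT xy) (pairs_neq CT yz).
  by move=> /(_ isT) ? /(_ isT); lia.
have cyc x y z : (x, y) \in C -> (y, z) \in C -> (z, x) \in C -> False.
  move=> xy yz zx.
  have [pi _ H] := @critical_avoid _ _ _ [:: (x, y); (y, z); (z, x)] cr CT C4.
  have := H _ _ xy; have := H _ _ yz; have := H _ _ zx.
  rewrite !inE !eqxx !orbT => /(_ isT) ? /(_ isT) ? /(_ isT); lia.
by move=> x y z /orP[a|a] /orP[b|b] /orP[c|c]; eauto.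
Qed.

Lemma mul_le_sqr_div4 a b : a * b <= (a + b) ^ 2 %/ 4.
Proof. by rewrite leq_divRL // mulnC nat_AGM2. Qed.

Lemma critical_le n (P : {set 'S_n}) C :
  critical P C -> C \subset pairs n -> 3 < #|P| -> #|P| <= n ^ 2 %/ 4.
Proof.
move=> cr CT; rewrite -(critical_card cr) => C4.
have [N [le _]] := mantel (fun x y => @critical_asym _ _ _ x y cr CT (ltnW C4))
                         (critical_triangle_free cr CT C4).
apply: leq_trans le _; rewrite -[X in X ^ 2]card_ord -(cardsC N).
exact: mul_le_sqr_div4.
Qed.

(** * The equality case: critical sets are cuts *)

Lemma factors_gt1 n a b : a + b = n -> n < a * b -> 1 < a /\ 1 < b.
Proof. by case: a b => [|[|a]] [|[|b]]; lia. Qed.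

(** For [n] at least 5 there are more than [n] edges, too many for a star, so each side has two
    vertices. *)
Lemma critical_bipartite n (P : {set 'S_n}) C :
    critical P C -> C \subset pairs n -> 5 <= n -> #|C| = n ^ 2 %/ 4 ->
  exists N : {set 'I_n}, [/\ 1 < #|N|, 1 < #|~: N| &
    forall x y, adj C x y = ((x \in N) != (y \in N))].
Proof.
move=> cr CT n5 Ccard.
have C6 : n < #|C| by rewrite Ccard leq_divRL //; nia.
have C4 : 3 < #|C| by lia.
have [N [le eqN]] := mantel (fun x y => @critical_asym _ _ _ x y cr CT (ltnW C4))
                         (critical_triangle_free cr CT C4).
have cN := cardsC N; rewrite card_ord in cN.
have [N2 M2] := factors_gt1 cN (leq_trans C6 le).
exists N; split=> //; apply: eqN.
apply/eqP; rewrite eqn_leq le Ccard -[X in X ^ 2]cN; exact: mul_le_sqr_div4.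
Qed.

Definition cut n (A : {set 'I_n}) : {set 'I_n * 'I_n} := setX A (~: A).

Lemma in_cut n (A : {set 'I_n}) x y :
  ((x, y) \in cut A) = (x \in A) && (y \notin A).
Proof. by rewrite in_setX in_setC. Qed.

Lemma cut_pairs n (A : {set 'I_n}) : cut A \subset pairs n.
Proof.
apply/subsetP=> -[x y]; rewrite in_cut inE /= => /andP[xA].
by apply: contraNneq => <-.
Qed.

(* Pair-completeness excludes a directed path x -> y -> z: with a second
   common neighbour y' of x and z, each permutation of [P] would put z before
   x. *)
Lemma critical_cut n (P : {set 'S_n}) C :
    critical P C -> C \subset pairs n -> 5 <= n -> #|C| = n ^ 2 %/ 4 ->
    pair_complete P ->
  exists A, C = cut A.
Proof.
move=> cr CT n5 Ccard cP.
have C5 : 4 < #|C| by rewrite Ccard leq_divRL //; nia.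
have asymC x y : (x, y) \in C -> (y, x) \notin C.
  by apply: critical_asym cr CT _; lia.
have [N [N2 M2 adjN]] := critical_bipartite cr CT n5 Ccard.
have other x y z : (x, y) \in C -> (y, z) \in C ->
    exists2 y', y' != y & adj C x y' && adj C y' z.
  move=> xy yz.
  have : adj C x y by rewrite /adj xy.
  have : adj C y z by rewrite /adj yz.
  rewrite !adjN; have [yN|yN] := boolP (y \in N).
    move=> zN xN; have /set0Pn[y'] : N :\ y != set0.
      by rewrite -card_gt0; move: N2; rewrite (cardsD1 y) yN.
    rewrite !inE => /andP[ne y'N]; exists y' => //; rewrite !adjN y'N.
    by move: zN xN; do 2!case: (_ \in N).
  move=> zN xN.
  have /set0Pn[y'] : ~: N :\ y != set0.
    by rewrite -card_gt0; move: M2; rewrite (cardsD1 y) inE yN.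
  rewrite !inE => /andP[ne y'N]; exists y' => //; rewrite !adjN (negbTE y'N).
  by move: zN xN; do 2!case: (_ \in N).
have nopath x y z : (x, y) \in C -> (y, z) \in C -> False.
  move=> xy yz; have [y' ne /andP[xy' y'z]] := other x y z xy yz.
  have nxz : x != z.
    by apply/eqP=> E; move: (asymC _ _ xy); rewrite E yz.
  have nxy := pairs_neq CT xy; have nyz := pairs_neq CT yz.
  (* Cases by the direction of the two edges at [y']. With two directed paths from [x] to [z], a
     permutation realises at most one arc, so one path is fully reversed and [(x, z)] is never
     covered. If just one edge follows this direction or its opposite consistently with a shortcut
     of a directed path of length 3, the flipper of the shortcut closes a cycle. The last case is a
     directed 4-cycle. *)
  case/orP: xy' => xy'; case/orP: y'z => y'z.
  - have /(completeP _ _ cP)[pi piP] : (x, z) \in pairs n by rewrite inE.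
    rewrite coversE => lt; have [c cC [_ fl]] := critical_flips cr CT piP.
    have [cs|cs] := boolP (c \in [:: (x, y); (y, z)]).
      have := fl _ _ xy'; have := fl _ _ y'z.
      rewrite !inE in cs; case/orP: cs => /eqP ->; rewrite !xpair_eqE.
        rewrite [z == y]eq_sym (negbTE nyz) (negbTE ne) !andbF /=.
        by move=> /(_ isT) h1 /(_ isT) h2; clear -lt h1 h2; lia.
      rewrite (negbTE ne) (negbTE nxy) /=.
      by move=> /(_ isT) h1 /(_ isT) h2; clear -lt h1 h2; lia.
    rewrite !inE negb_or ![c == _]eq_sym in cs; case/andP: cs => c1 c2.
    by have h1 := fl _ _ xy c1; have h2 := fl _ _ yz c2; clear -lt h1 h2; lia.
  - have [pi _ [/= lt fl]] := critical_flipper cr CT xy'.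
    have := fl _ _ xy; have := fl _ _ yz; have := fl _ _ y'z.
    rewrite !xpair_eqE [z == x]eq_sym (negbTE nxz).
    rewrite [y == x]eq_sym (negbTE nxy) [y == y']eq_sym (negbTE ne) !andbF /=.
    by move=> /(_ isT) h1 /(_ isT) h2 /(_ isT) h3; clear -lt h1 h2 h3; lia.
  - have [pi _ [/= lt fl]] := critical_flipper cr CT y'z.
    have := fl _ _ xy; have := fl _ _ yz; have := fl _ _ xy'.
    rewrite !xpair_eqE (negbTE nxz) [y == y']eq_sym (negbTE ne).
    rewrite (negbTE nyz) !andbF /=.
    by move=> /(_ isT) h1 /(_ isT) h2 /(_ isT) h3; clear -lt h1 h2 h3; lia.
  - have [pi _ H] :=
      @critical_avoid _ _ _ [:: (x, y); (y, z); (z, y'); (y', x)] cr CT C5.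
    have := H _ _ xy; have := H _ _ yz; have := H _ _ xy'; have := H _ _ y'z.
    rewrite !inE !eqxx !orbT.
    by move=> /(_ isT) h1 /(_ isT) h2 /(_ isT) h3 /(_ isT) h4; clear -h1 h2 h3 h4; lia.
(* The set of tails. If a tail [x] and a non-tail [y] were not adjacent, they would be on the same
   side, so an out-neighbour [w] of [x] would be adjacent to [y], giving an arc out of [y] or a
   directed path of length 2. *)
exists [set x | [exists y, (x, y) \in C]]; apply/setP=> -[x y].
rewrite in_cut !inE negb_exists; apply/idP/andP => [xy|[/existsP[w xw] /forallP Hy]].
  split; first by apply/existsP; exists y.
  by apply/forallP=> z; apply/negP => yz; apply: nopath xy yz.
have [dif|same] := boolP (adj C x y).
  by case/orP: dif => // yx; move: (Hy x); rewrite yx.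
have : adj C y w.
  have : adj C x w by rewrite /adj xw.
  by move: same; rewrite !adjN; do 3!case: (_ \in N).
case/orP=> yw; first by move: (Hy w); rewrite yw.
by case: (nopath _ _ _ xw yw).
Qed.

Lemma inversions_pairs n : inversions n \subset pairs n.
Proof. by apply/subsetP=> -[x y]; rewrite !inE /=; apply: contraTneq => ->; rewrite ltnn. Qed.

(** * Lower bounds and the value of [gammaP] *)

(** The permutations covering at most one pair of [C] form a pair-complete set. A minimal
    pair-complete subset of it needs a different permutation for each pair of [C]. *)
Lemma gammaP_ge n (C : {set 'I_n * 'I_n}) :
    C \subset pairs n ->
    (forall i j, i != j -> exists pi : 'S_n, covers pi (i, j) /\
       {in C &, forall c d, covers pi c -> covers pi d -> c = d}) ->
  #|C| <= gammaP n.
Proof.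
move=> CT H.
pose P0 : {set 'S_n} := [set pi | [forall c in C, forall d in C,
  covers pi c ==> covers pi d ==> (c == d)]].
have P0P pi : reflect {in C &, forall c d, covers pi c -> covers pi d -> c = d}
                      (pi \in P0).
  rewrite inE; apply: (iffP forall_inP) => [K c d cC dC cc cd|K c cC].
    by have /forall_inP/(_ d dC) := K c cC; rewrite cc cd => /eqP.
  apply/forall_inP=> d dC; apply/implyP=> cc; apply/implyP=> cd.
  exact/eqP/K.
have /minset_exists[P minP PP0] : complete (pairs n) P0.
  apply/completeP=> -[i j]; rewrite inE => /H[pi [cov /P0P piP0]].
  by exists pi.
have cP := minsetp minP.
have coverer c : exists pi, c \in C -> pi \in P /\ covers pi c.
  have [cC|] := boolP (c \in C); last by exists 1%g.
  by have [pi piP cov] := completeP _ _ cP c (subsetP CT c cC); exists pi.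
have [g gP] := fin_all_exists coverer.
have ginj : {in C &, injective g}.
  move=> c d cC dC E; have [gcP cc] := gP c cC; have [_ cd] := gP d dC.
  by have /P0P := subsetP PP0 _ gcP; apply=> //; rewrite E.
rewrite -(card_in_imset ginj); apply: (@leq_trans #|P|).
  by apply: subset_leq_card; apply/subsetP=> _ /imsetP[c cC ->]; case: (gP c cC).
exact: (@leq_bigmax_cond _ (@min_pair_complete n) (fun P => #|P|)).
Qed.

Lemma cut_covered_once n (A : {set 'I_n}) i j : i != j ->
  exists pi : 'S_n, covers pi (i, j) /\
    {in cut A &, forall c d, covers pi c -> covers pi d -> c = d}.
Proof.
move=> ij; have [ijA|ijA] := boolP ((i, j) \in cut A).
  (* The order is: the rest of the complement, [i], [j], the rest of [A]. *)
  pose r x := if x \in A then (if x == i then 1 else 3)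
              else (if x == j then 2 else 0).
  have [pi H] := perm_of_rank r; exists pi; split.
    by apply: H; move: ijA; rewrite in_cut /r => /andP[-> /negbTE ->]; rewrite !eqxx.
  suff K c : c \in cut A -> covers pi c -> c = (i, j).
    by move=> c d cA dA cc cd; rewrite (K c cA cc) (K d dA cd).
  case: c => a b; rewrite in_cut => /andP[aA bA] cov.
  have : ~~ (r b < r a).
    by apply/negP => /H; move: cov; rewrite !coversE; lia.
  rewrite /r aA (negbTE bA); case: eqP => [->|]; case: eqP => [->|] //.
(* The complement precedes [A], and [j] comes last within its own block. *)
pose r x := 2 * (x \in A) + (x == j).
have [pi H] := perm_of_rank r; exists pi; split.
  apply: H; move: ijA; rewrite in_cut /r eqxx (negbTE ij).
  by case: (i \in A); case: (j \in A).
suff K c : c \in cut A -> covers pi c -> False.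
  by move=> c d cA dA /(K c cA).
case: c => a b; rewrite in_cut => /andP[aA bA].
have : r b < r a by rewrite /r aA (negbTE bA); do 2!case: (_ == _).
by move/H; rewrite !coversE; lia.
Qed.

Lemma cardsC_ord n (A : {set 'I_n}) : #|~: A| = n - #|A|.
Proof. by rewrite cardsCs setCK card_ord. Qed.

Lemma sqr_div4 n : n ^ 2 %/ 4 = n %/ 2 * (n - n %/ 2).
Proof.
have := divn_eq n 2; have := ltn_pmod n (isT : 0 < 2).
move: (n %/ 2) (n %% 2) => k e e2 ->.
have -> : (k * 2 + e) ^ 2 = k * (k + e) * 4 + e * e.
  by rewrite -mulnn; lia.
rewrite divnMDl // divn_small; last by case: e e2 => [|[|]].
by rewrite addn0; congr (_ * _); lia.
Qed.

Lemma gammaP_ge_sqr n : n ^ 2 %/ 4 <= gammaP n.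
Proof.
pose A := [set x : 'I_n | x < n %/ 2].
have cA : #|A| = n %/ 2.
  rewrite -sum1dep_card -(big_ord_widen n (fun=> 1)) ?sum1_card ?card_ord //.
  exact: leq_div.
apply: leq_trans (gammaP_ge (cut_pairs A) (@cut_covered_once n A)).
by rewrite cardsX cardsC_ord cA sqr_div4.
Qed.

(* For n = 2, 3 the extremal critical sets are the directed n-cycles. *)
Lemma gammaP_ge_small n : 2 <= n <= 3 -> n <= gammaP n.
Proof.
move=> n23.
have Sinj : injective (fun x : 'I_n => (x, ordS x)) by move=> x y [].
rewrite -[X in X <= _]card_ord -cardsT -(card_imset _ Sinj).
apply: gammaP_ge.
  apply/subsetP=> _ /imsetP[x _ ->]; rewrite inE -val_eqE /=.
  case: x => x ltx /=; move: (n23) ltx.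
  by case/andP: n23; case: n Sinj => [|[|[|[|]]]] //; case: x => [|[|[|]]].
(* A third element goes between [i] and [j] if [j] is the successor of [i], and before both
   otherwise; either way a single arc of the cycle is realised. *)
move=> i j ij; pose r x := if x == j then 2 else if x == i then
  (if j == ordS i then 0 else 1) else (if j == ordS i then 1 else 0).
have [pi H] := perm_of_rank r; exists pi; split.
  by apply: H; rewrite /r eqxx (negbTE ij) eqxx; case: ifP.
have K x : covers pi (x, ordS x) -> r x <= r (ordS x).
  by rewrite leqNgt => cov; apply/negP => /H; move: cov; rewrite !coversE; lia.
move=> _ _ /imsetP[x _ ->] /imsetP[y _ ->] /K rx /K ry.
suff -> : x = y by [].
apply/eqP; move: ij rx ry; rewrite /r -!val_eqE /=.
case: i j x y {r H K} => [i lti] [j ltj] [x ltx] [y lty] /=.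
move: n23 lti ltj ltx lty; case: n Sinj pi => [|[|[|[|]]]] //= _ _ _.
  by case: i => [|[|]] //; case: j => [|[|]] //; case: x => [|[|]] //; case: y => [|[|]].
by case: i => [|[|[|]]] //; case: j => [|[|[|]]] //; case: x => [|[|[|]]] //; case: y => [|[|[|]]].
Qed.

Lemma gammaPE n : 2 <= n -> gammaP n = maxn n (n ^ 2 %/ 4).
Proof.
move=> n2; apply/eqP; rewrite eqn_leq; apply/andP; split.
  apply/bigmax_leqP=> P /minset_completeP[|_ [C CT cr]]; first by lia.
  have [P4|P3] := ltnP 3 #|P|; first by rewrite leq_max (critical_le cr CT P4) orbT.
  rewrite leq_max; apply/orP; left; have [n3|n3] := leqP 3 n; first exact: leq_trans n3.
  have {n3}n2 : n = 2 by lia.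
  by subst n; apply: leq_trans (max_card _) _; rewrite card_Sn.
rewrite geq_max gammaP_ge_sqr andbT.
have [n3|n3] := leqP n 3; first by rewrite gammaP_ge_small ?n2.
by apply: leq_trans (gammaP_ge_sqr n); rewrite leq_divRL //; nia.
Qed.

Lemma gammaP_large n : 5 <= n -> gammaP n = n ^ 2 %/ 4.
Proof.
by move=> n5; rewrite gammaPE; [apply/maxn_idPr; rewrite leq_divRL //; nia | lia].
Qed.

(** * Maximum sets and relabelling *)

Lemma card_cut n (A : {set 'I_n}) : #|cut A| = #|A| * #|~: A|.
Proof. exact: cardsX. Qed.

(** Trades minimality for a critical cut, a condition that relabelling visibly preserves. *)
Lemma PstarP n (P : {set 'S_n}) : 5 <= n ->
  reflect [/\ pair_complete P, #|P| = n ^ 2 %/ 4 & exists A, critical P (cut A)]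
          (P \in Pstar n).
Proof.
move=> n5; have n0 : 0 < n by lia.
rewrite inE gammaP_large //; apply: (iffP andP).
  move=> [/minset_completeP-/(_ n0)[cP [C CT cr]] /eqP Pcard]; split=> //.
  have [|A CA] := critical_cut cr CT n5 _ cP; first by rewrite (critical_card cr).
  by exists A; rewrite -CA.
move=> [cP -> [A cr]]; split=> //; apply/minset_completeP => //; split=> //.
by exists (cut A) => //; apply: cut_pairs.
Qed.

Lemma compsetK n (tau : 'S_n) : cancel (compset tau) (compset tau^-1).
Proof.
move=> P; rewrite /compset -imset_comp -[RHS]imset_id.
by apply: eq_imset => pi /=; rewrite mulgK.
Qed.

Lemma compsetKV n (tau : 'S_n) : cancel (compset tau^-1) (compset tau).
Proof. by move=> P; rewrite -[X in compset X]invgK compsetK. Qed.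

Lemma card_compset n (tau : 'S_n) P : #|compset tau P| = #|P|.
Proof. by apply: card_imset; apply: mulIg. Qed.

Lemma compset_complete n (tau : 'S_n) P :
  pair_complete P -> pair_complete (compset tau P).
Proof.
move=> /completeP cP; apply/completeP=> -[x y]; rewrite inE /= => xy.
have [|pi piP cov] := cP ((tau^-1)%g x, (tau^-1)%g y).
  by rewrite inE /= (inj_eq perm_inj).
exists (pi * tau)%g; first exact: (imset_f (mulg^~ tau)).
by rewrite -[x](permKV tau) -[y](permKV tau) coversM.
Qed.

Lemma compset_critical n (tau : 'S_n) P A :
  critical P (cut A) -> critical (compset tau P) (cut (tau @: A)).
Proof.
case/criticalP=> f fP H; pose t (c : 'I_n * 'I_n) := (tau c.1, tau c.2).
have fE pi : [ffun rho => t (f (rho * tau^-1)%g)] (pi * tau)%g = t (f pi).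
  by rewrite ffunE mulgK.
apply/criticalP; exists [ffun rho => t (f (rho * tau^-1)%g)].
  rewrite -imset_comp; transitivity (t @: (f @: P)).
    by rewrite -imset_comp; apply: eq_imset => pi; apply: fE.
  rewrite fP; apply/setP=> -[x y]; rewrite in_cut; apply/imsetP/andP.
    case=> -[a b]; rewrite in_cut => /andP[aA bA] [-> ->].
    by rewrite !(mem_imset _ _ perm_inj).
  case=> /imsetP[a aA ->]; rewrite -[y](permKV tau) (mem_imset _ _ perm_inj) => bA.
  by exists (a, (tau^-1)%g y); rewrite ?in_cut ?aA.
move=> _ _ /imsetP[pi piP ->] /imsetP[rho rhoP ->].
rewrite fE coversM -surjective_pairing H //.
by rewrite (inj_eq (mulIg tau)).
Qed.

Lemma Pstar_compset n (tau : 'S_n) P :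
  5 <= n -> P \in Pstar n -> compset tau P \in Pstar n.
Proof.
move=> n5 /PstarP-/(_ n5)[cP Pcard [A cr]]; apply/PstarP => //.
split; [exact: compset_complete | by rewrite card_compset |].
by exists (tau @: A); apply: compset_critical.
Qed.

Lemma Pstar_neq0 n : 5 <= n -> exists P, P \in Pstar n.
Proof.
move=> n5; apply/set0Pn/negP => /eqP P0.
have : gammaP n <= (n ^ 2 %/ 4).-1.
  apply/bigmax_leqP=> P minP.
  have : #|P| <= gammaP n.
    exact: (@leq_bigmax_cond _ (@min_pair_complete n) (fun P => #|P|)).
  rewrite leq_eqVlt; have : P \notin Pstar n by rewrite P0 inE.
  rewrite inE minP /= => /negbTE ->; rewrite gammaP_large //=.
  by case: (n ^ 2 %/ 4).
rewrite gammaP_large //; have : 0 < n ^ 2 %/ 4 by rewrite divn_gt0 //; nia.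
by case: (n ^ 2 %/ 4) => // m _; rewrite ltnn.
Qed.

(** * Uniqueness of the cut *)

Lemma critical_uniq n (P : {set 'S_n}) C c pi rho :
  critical P C -> c \in C -> pi \in P -> rho \in P ->
  covers pi c -> covers rho c -> pi = rho.
Proof.
case/criticalP=> f <- H /imsetP[s sP ->] piP rhoP.
by rewrite !H // => /eqP -> /eqP ->.
Qed.

(** Let [x] be in [B] but not in [A]. If some [y] is in [A] but not in [B], every permutation covers
    [(x, y)] or [(y, x)], each of which is private, so [P] has at most two members. Otherwise [A]
    lies in [B], and the flipper of an arc [(a, b)] of [cut A] with [b] outside [B] puts [x] before
    [a] before [b], thus covering two arcs of [cut B]. *)
Lemma critical_cut_sub n (P : {set 'S_n}) A B :
    2 < #|P| -> critical P (cut A) -> critical P (cut B) -> B \subset A.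
Proof.
move=> P3 crA crB; apply/negPn/negP => /subsetPn[x xB xA].
have AB : A \subset B.
  apply/negPn/negP => /subsetPn[y yA yB].
  have xyB : (x, y) \in cut B by rewrite in_cut xB.
  have yxA : (y, x) \in cut A by rewrite in_cut yA.
  have card1 D c : critical P D -> c \in D -> #|[set pi in P | covers pi c]| <= 1.
    move=> cr cD; apply/card_le1_eqP=> pi rho; rewrite !inE.
    by move=> /andP[piP cpi] /andP[rhoP crho]; apply: (critical_uniq cr cD).
  have := leq_add (card1 _ _ crB xyB) (card1 _ _ crA yxA).
  rewrite leqNgt => /negP; apply; apply: leq_trans P3 _.
  apply: leq_trans (leq_card_setU _ _); apply: subset_leq_card.
  apply/subsetP=> pi piP; rewrite !inE piP /= !coversE.
  have : x != y by apply: contraNneq xA => ->.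
  by move/(pos_neq pi); case: ltngtP.
have P0 D : critical P D -> 0 < #|D| by move/critical_card ->; lia.
have [[a a'] /[!in_cut]/andP[aA _]] : exists c, c \in cut A.
  by apply/set0Pn; rewrite -card_gt0 P0.
have [[b' b] /[!in_cut]/andP[_ bB]] : exists c, c \in cut B.
  by apply/set0Pn; rewrite -card_gt0 P0.
have aB := subsetP AB a aA; have bA : b \notin A by apply: contra bB; apply: subsetP.
have ab : (a, b) \in cut A by rewrite in_cut aA.
have [pi piP [/= lt_ab flA]] := critical_flipper crA (cut_pairs A) ab.
have lt_xa : pos pi x < pos pi a.
  apply: flA; rewrite ?in_cut ?aA // xpair_eqE eqxx /=.
  by apply: contraNneq bB => <-.
have [c _ [_ flB]] := critical_flips crB (cut_pairs B) piP.
have [cE|ne] := eqVneq (a, b) c.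
  have := flB x b; rewrite in_cut xB bB -cE xpair_eqE eqxx !andbT.
  have -> : x != a by apply: contraNneq xA => ->.
  by move=> /(_ isT isT); lia.
by have := flB a b; rewrite in_cut aB bB ne => /(_ isT isT); lia.
Qed.

Lemma critical_cut_inj n (P : {set 'S_n}) A B :
    2 < #|P| -> critical P (cut A) -> critical P (cut B) -> A = B.
Proof.
by move=> P3 cA cB; apply/eqP; rewrite eqEsubset !(@critical_cut_sub _ P).
Qed.

(** * Cuts made of inversions and inversion-complete sets *)

Lemma exists_cut_inversions n (A : {set 'I_n}) :
  exists sigma : 'S_n, cut (sigma @: A) \subset inversions n.
Proof.
have [pi H] := perm_of_rank (fun x => x \in A : nat).
exists (pi^-1)%g; apply/subsetP=> -[x y]; rewrite in_cut inE /=.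
case/andP=> /imsetP[a aA ->]; rewrite -[y](permK pi) (mem_imset _ _ perm_inj).
by move=> bA; have := H (pi y) a; rewrite aA (negbTE bA) coversE; apply.
Qed.

(** Both sets are final segments of ['I_n], determined by their size. *)
Lemma cut_inversions_inj n (A B : {set 'I_n}) :
    cut A \subset inversions n -> cut B \subset inversions n ->
  #|A| = #|B| -> A = B.
Proof.
move=> /subsetP invA /subsetP invB cAB; apply/eqP; rewrite eqEcard cAB leqnn andbT.
apply/negPn/negP => /subsetPn[x xA xB].
have /subsetPn[y yB yA] : ~~ (B \subset A).
  apply/negP=> BA; have /eqP E : B == A by rewrite eqEcard BA cAB leqnn.
  by rewrite E xA in xB.
have := invA (x, y); have := invB (y, x); rewrite !in_cut xA yB xB yA !inE /=.
by move=> /(_ isT) ? /(_ isT); lia.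
Qed.

Lemma critical_inversions_complete n (Q : {set 'S_n}) C :
    5 <= n -> inversion_complete Q -> critical Q C -> C \subset inversions n ->
    #|C| = n ^ 2 %/ 4 ->
  pair_complete Q.
Proof.
move=> n5 cQ cr Cinv Ccard.
have CT := subset_trans Cinv (inversions_pairs n).
have C3 : 2 < #|C| by rewrite Ccard leq_divRL //; nia.
have C2 := ltnW C3.
have [N [N2 M2 adjN]] := critical_bipartite cr CT n5 Ccard.
clear Ccard n5; apply/completeP=> -[i j]; rewrite inE /= => ij.
have [dif|same] := boolP (adj C i j).
  case/orP: dif => ijC.
    have [pi piQ [lt _]] := critical_flipper cr CT ijC.
    by exists pi; rewrite ?coversE.
  have [pi piQ H] := @critical_avoid _ _ _ [:: (j, i)] cr CT C2.
  by exists pi; rewrite // coversE H ?inE.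
have [b] : exists b, adj C i b && adj C j b.
  move: same; rewrite adjN negbK => /eqP same.
  have [iN|iN] := boolP (i \in N).
    have /set0Pn[b] : ~: N != set0 by rewrite -card_gt0 ltnW.
    by rewrite inE => /negbTE bN; exists b; rewrite !adjN -same iN bN.
  have /set0Pn[b] : N != set0 by rewrite -card_gt0 ltnW.
  by move=> bN; exists b; rewrite !adjN -same (negbTE iN) bN.
(* The aim is [i] before [b] before [j], which realises at most one arc at [b] unless the arcs form
   a path from [i] to [j]; in that case [(i, j)] is itself an inversion. *)
case/andP=> /orP[ib|bi] /orP[jb|bj].
- have [pi piQ [/= lt fl]] := critical_flipper cr CT ib.
  exists pi => //; rewrite coversE; apply: ltn_trans lt (fl _ _ jb _).
  by rewrite xpair_eqE eqxx andbT eq_sym.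
- have := subsetP Cinv _ ib; have := subsetP Cinv _ bj; rewrite !inE /= => jb bi.
  by apply: (completeP _ _ cQ); rewrite inE /= (ltn_trans jb bi).
- have [pi piQ H] := @critical_avoid _ _ _ [:: (b, i); (j, b)] cr CT C3.
  exists pi => //; rewrite coversE; apply: (@ltn_trans (pos pi b)).
    by apply: H; rewrite // !inE eqxx.
  by apply: H; rewrite // !inE eqxx orbT.
- have [pi piQ [/= lt fl]] := critical_flipper cr CT bj.
  exists pi => //; rewrite coversE; apply: ltn_trans (fl _ _ bi _) lt.
  by rewrite xpair_eqE eqxx.
Qed.

Lemma pair_inversion_complete n (P : {set 'S_n}) :
  pair_complete P -> inversion_complete P.
Proof.
move=> /completeP cP; apply/completeP=> c /(subsetP (inversions_pairs n)).
exact: cP.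
Qed.

(** The upper bound for critical sets applies again. It is attained by relabelling a member of
    [Pstar n] until its cut consists of inversions: the same private pairs then show minimality for
    inversions. *)
Lemma gammaQ_large n : 5 <= n -> gammaQ n = n ^ 2 %/ 4.
Proof.
move=> n5; have n0 : 0 < n by lia.
apply/eqP; rewrite eqn_leq; apply/andP; split.
  apply/bigmax_leqP=> Q /minset_completeP-/(_ n0)[_ [C Cinv cr]].
  have [Q4|Q3] := ltnP 3 #|Q|.
    exact: critical_le cr (subset_trans Cinv (inversions_pairs n)) Q4.
  by apply: leq_trans Q3 _; rewrite leq_divRL //; nia.
have [P /PstarP-/(_ n5)[cP <- [A cr]]] := Pstar_neq0 n5.
have [sigma inv] := exists_cut_inversions A.
rewrite -(card_compset sigma P).
apply: (@leq_bigmax_cond _ (@min_inversion_complete n) (fun Q => #|Q|)).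
apply/minset_completeP => //; split.
  exact/pair_inversion_complete/compset_complete.
by exists (cut (sigma @: A)); rewrite ?compset_critical.
Qed.

Lemma QstarP n (Q : {set 'S_n}) : 5 <= n ->
  reflect (Q \in Pstar n /\
           exists2 A, critical Q (cut A) & cut A \subset inversions n)
          (Q \in Qstar n).
Proof.
move=> n5; have n0 : 0 < n by lia.
rewrite [Q \in Qstar n]inE gammaQ_large //; apply: (iffP andP).
  move=> [/minset_completeP-/(_ n0)[cQ [C Cinv cr]] /eqP Qcard].
  have Ccard := critical_card cr; rewrite Qcard in Ccard.
  have cP := critical_inversions_complete n5 cQ cr Cinv Ccard.
  have [A CA] := critical_cut cr (subset_trans Cinv (inversions_pairs n)) n5 Ccard cP.
  rewrite CA in cr Cinv; split; last by exists A.
  by apply/PstarP => //; split=> //; exists A.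
move=> [/PstarP-/(_ n5)[cP -> _] [A cr inv]]; split=> //.
apply/minset_completeP => //; split; first exact: pair_inversion_complete.
by exists (cut A).
Qed.

Lemma PstarE n : 5 <= n ->
  Pstar n = [set compset tau Q | tau in [set: 'S_n], Q in Qstar n].
Proof.
move=> n5; apply/setP=> P; apply/idP/imset2P => [Pst|[tau Q _ /QstarP-/(_ n5)[Qst _] ->]].
  have /PstarP-/(_ n5)[_ _ [A cr]] := Pst.
  have [sigma inv] := exists_cut_inversions A.
  exists (sigma^-1)%g (compset sigma P); rewrite ?compsetK ?in_setT //.
  apply/QstarP => //; split; first exact: Pstar_compset.
  by exists (sigma @: A); rewrite ?compset_critical.
exact: Pstar_compset.
Qed.

(** * Sources and the counting of [Pstar] *)

(** The square of [a - b] is less than 4, so the factors differ by at most 1. *)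
Lemma balanced_factors n a b :
  a + b = n -> a * b = n ^ 2 %/ 4 -> a != n %/ 2 -> a = n - n %/ 2.
Proof.
move=> <- E.
have : (a + b) ^ 2 < 4 * (a * b) + 4 by rewrite E; lia.
move: E => _ lt ne.
have : a <= b + 1 by nia.
have : b <= a + 1 by nia.
by lia.
Qed.

(** The choice is unambiguous once [P] has more than two members; [set0] is a default for sets
    without a critical cut. *)
Definition source n (P : {set 'S_n}) : {set 'I_n} :=
  odflt set0 [pick A | critical P (cut A)].

Lemma sourceE n (P : {set 'S_n}) A :
  2 < #|P| -> critical P (cut A) -> source P = A.
Proof.
move=> P3 cr; rewrite /source; case: pickP => [B /= crB|/(_ A)]; last by rewrite cr.
exact: critical_cut_inj P3 crB cr.
Qed.

(* A member of [Pstar n] with source [A] is the relabelling, by a fixed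
   permutation sending [A] to a final segment, of a member of [Qstar n]; and
   [A] or its complement has n/2 elements, according to the size of the
   source. *)
Lemma card_Pstar n : 5 <= n ->
  #|Pstar n| = #|[set D : {set 'I_n} | #|D| == n %/ 2]| * #|Qstar n|.
Proof.
move=> n5; have [sigma sigmaP] := fin_all_exists (@exists_cut_inversions n).
pose side (DQ : {set 'I_n} * {set 'S_n}) :=
  if #|source DQ.2| == n %/ 2 then DQ.1 else ~: DQ.1.
pose h DQ := compset (sigma (side DQ))^-1 DQ.2.
have P3 P : P \in Pstar n -> 2 < #|P|.
  by move=> /PstarP-/(_ n5)[_ -> _]; rewrite leq_divRL //; nia.
have card_source P A : P \in Pstar n -> critical P (cut A) -> #|A| != n %/ 2 ->
    #|A| = n - n %/ 2.
  move=> /PstarP-/(_ n5)[_ Pcard _] cr; apply: (@balanced_factors _ _ #|~: A|).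
    by rewrite cardsC card_ord.
  by rewrite -card_cut (critical_card cr).
set X := [set D : {set 'I_n} | _].
have hP (D : {set 'I_n}) (Q : {set 'S_n}) : D \in X -> Q \in Qstar n ->
    [/\ h (D, Q) \in Pstar n, source (h (D, Q)) = side (D, Q)
      & #|side (D, Q)| = #|source Q|].
  rewrite inE => /eqP cD /QstarP-/(_ n5)[Qst [A cr inv]].
  have sE := sourceE (P3 _ Qst) cr.
  have cs : #|side (D, Q)| = #|A|.
    rewrite /side sE /=; case: eqP => [-> //|/eqP ne].
    by rewrite cardsC_ord cD (card_source Q A).
  have hst : h (D, Q) \in Pstar n by apply: Pstar_compset.
  split; rewrite ?sE //; apply: sourceE; first exact: P3.
  set B := side (D, Q) in cs *.
  (* Both sides are final segments of equal size, so undoing [sigma B] carries the source of [Q] to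
     [B]. *)
  have AE : A = sigma B @: B.
    apply: (cut_inversions_inj inv (sigmaP B)).
    by rewrite -cs card_imset //; apply: perm_inj.
  have -> : B = (sigma B)^-1%g @: A.
    rewrite AE -imset_comp -[LHS]imset_id.
    by apply: eq_imset => x /=; rewrite permK.
  exact: compset_critical.
rewrite -cardsX -(@card_in_imset _ _ h).
  apply: eq_card => P; apply/idP/imsetP; last first.
    by case=> -[D Q] /setXP[DX Qst] ->; case: (hP D Q DX Qst).
  move=> Pst; have /PstarP-/(_ n5)[_ _ [A cr]] := Pst.
  have Qst : compset (sigma A) P \in Qstar n.
    apply/QstarP => //; split; first exact: Pstar_compset.
    by exists (sigma A @: A); rewrite ?compset_critical.
  have /QstarP-/(_ n5)[QstP _] := Qst.
  have sE := sourceE (P3 _ QstP) (compset_critical (sigma A) cr).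
  have cA : #|sigma A @: A| = #|A| by apply: card_imset; apply: perm_inj.
  exists (if #|A| == n %/ 2 then A else ~: A, compset (sigma A) P).
    rewrite in_setX Qst inE andbT; case: ifP => // /negbT ne.
    by rewrite cardsC_ord (card_source P A) // subKn ?leq_div.
  rewrite /h; have -> : side (if #|A| == n %/ 2 then A else ~: A, compset (sigma A) P) = A.
    by rewrite /side /= sE cA; case: ifP => e; rewrite ?e ?setCK.
  by rewrite compsetK.
move=> [D Q] [D' Q'] /setXP[DX Qst] /setXP[DX' Qst'] E.
have [_ s1 c1] := hP _ _ DX Qst; have [_ s2 c2] := hP _ _ DX' Qst'.
have sideE : side (D, Q) = side (D', Q') by rewrite -s1 -s2 E.
have DE : D = D'.
  (* Sources of equal size select the same branch of [side], which is injective in [D]. *)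
  have cE : #|source Q| = #|source Q'| by rewrite -c1 -c2 sideE.
  move: (sideE); rewrite /side /= cE; case: ifP => // _.
  exact: (can_inj (@setCK _)).
move: E; rewrite /h sideE /= => /(can_inj (compsetKV _)) ->.
by rewrite DE.
Qed.

Lemma eq_card_bijective (T U : finType) :
  #|T| = #|U| -> exists f : T -> U, bijective f.
Proof.
move=> E; exists (fun x => enum_val (cast_ord E (enum_rank x))).
exists (fun y => enum_val (cast_ord (esym E) (enum_rank y))) => x.
  by rewrite enum_valK cast_ordK enum_rankK.
by rewrite enum_valK cast_ordKV enum_rankK.
Qed.

Theorem theorem2 (n : nat) (hn : 2 <= n) :
  [/\ gammaP n = maxn n (n ^ 2 %/ 4),
      (5 <= n ->
        Pstar n = [set compset tau Q | tau in [set: 'S_n], Q in Qstar n])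
    & (5 <= n ->
        exists f : {P : {set 'S_n} | P \in Pstar n} ->
                   {D : {set 'I_n} | #|D| == n %/ 2} *
                   {Q : {set 'S_n} | Q \in Qstar n},
          bijective f)].
Proof.
split; [exact: gammaPE | exact: PstarE | move=> n5].
apply: eq_card_bijective.
by rewrite card_prod !card_sig card_Pstar // cardsE.
Qed.
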